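(* Let $d,n\ge 1$ be integers and let $\Omega\subset\mathbb{R}^d$ be a diagonally-determined set with vector $\mathbf{v}$ and $\mathrm{diag}(\Omega)=[a,b]$, where $a<b$. Then $$\inf\{\|P\|_\Omega : P\in\Pi_n^*\}=\left(\frac{b-a}{2}\right)^n\frac{1}{2^{n-1}},$$ and the infimum is attained by the polynomial $$\mathbf{x}\mapsto P^*(\mathbf{x}):=\left(\frac{b-a}{2}\right)^n\frac{1}{2^{n-1}}\,T_n\!\left(-1+2\,\frac{\langle\mathbf{v},\mathbf{x}\rangle-a}{b-a}\right)$$ (that is, $P^*\in\Pi_n^*$ and $\|P^*\|_\Omega$ equals the infimum).
   Context: $\langle\cdot,\cdot\rangle$ is the standard inner product on $\mathbb{R}^d$ and $\mathbf{1}=(1,\dots,1)\in\mathbb{R}^d$. For $\Omega\subset\mathbb{R}^d$, $\mathrm{diag}(\Omega)=\{t\in\mathbb{R}: t\mathbf{1}\in\Omega\}$. The set $\Omega$ is called diagonally-determined, with vector $\mathbf{v}$ and $\mathrm{diag}(\Omega)=[a,b]$, if (1) $\mathrm{diag}(\Omega)$ is an interval $[a,b]$, and (2) $\mathbf{v}\in\mathbb{R}^d$ satisfies $\langle\mathbf{v},\mathbf{1}\rangle=1$ and $\langle\mathbf{v},\mathbf{x}\rangle\in[a,b]$ for all $\mathbf{x}\in\Omega$. No compactness of $\Omega$ is assumed. $\Pi^d_m$ is the space of real polynomials of total degree at most $m$ in $d$ variables. $\mathbb{N}^d_n=\{\alpha\in\mathbb{N}_0^d:|\alpha|=\alpha_1+\dots+\alpha_d=n\}$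 and $\mathbf{x}^\alpha=x_1^{\alpha_1}\cdots x_d^{\alpha_d}$. $\Pi_n^*$ is the set of polynomials $P(\mathbf{x})=\sum_{\alpha\in\mathbb{N}^d_n}a_\alpha\mathbf{x}^\alpha+Q(\mathbf{x})$ with $\sum_{\alpha\in\mathbb{N}^d_n}a_\alpha=1$ and $Q\in\Pi^d_{n-1}$. $\|P\|_\Omega=\sup_{\mathbf{x}\in\Omega}|P(\mathbf{x})|$ (possibly $+\infty$). $T_n$ is the classical univariate Chebyshev polynomial of the first kind, $T_n(x)=\cos(n\arccos x)$ on $[-1,1]$, extended as a polynomial to $\mathbb{R}$. *)

(* Defs.v *)
From HB Require Import structures.
From mathcomp Require Import all_boot all_order all_algebra.
(* mpoly has to be imported before the analysis files: in the other order
   their notation levels are incompatible. *)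
From mathcomp Require Import mpoly.
From mathcomp Require Import boolp classical_sets set_interval reals ereal.
From mathcomp Require Import trigo.

Set Implicit Arguments.
Unset Strict Implicit.
Unset Printing Implicit Defensive.

Import Order.TTheory GRing.Theory Num.Theory.
Local Open Scope ring_scope.
Local Open Scope classical_set_scope.

Section DiagonallyDetermined.
Variables (R : realType) (d : nat).
Implicit Types (x y v : 'rV[R]_d) (Omega : set 'rV[R]_d).

Definition dotv x y : R := \sum_(i < d) x 0 i * y 0 i.

Definition onev : 'rV[R]_d := const_mx 1.

Definition diagset Omega : set R := [set t | Omega (t *: onev)].

Definition diagonally_determined Omega v (a b : R) : Prop :=
  [/\ diagset Omega = `[a, b],
      dotv v onev = 1
    & forall x, Omega x -> a <= dotv v x <= b].

End DiagonallyDetermined.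

Section Polynomials.
Variables (R : realType) (d : nat).

(* [msize p] is 1 + the total degree of p, and 0 if p = 0. *)
Definition Pi_le (m : nat) : set {mpoly R[d]} := [set p | (msize p <= m.+1)%N].

(* 'X_{1..d < n.+1} is the finite type of multi-indices of degree at most n.
   Since [n.-1] is 0 for n = 0, this is the intended set only for n >= 1. *)
Definition Pi_star (n : nat) : set {mpoly R[d]} :=
  [set P | exists (a : 'X_{1..d} -> R) (Q : {mpoly R[d]}),
     [/\ \sum_(m : 'X_{1..d < n.+1} | mdeg m == n) a m = 1,
         Pi_le n.-1 Q
       & P = \sum_(m : 'X_{1..d < n.+1} | mdeg m == n) a m *: 'X_[m] + Q]].

Definition supnorm (Omega : set 'rV[R]_d) (P : {mpoly R[d]}) : \bar R :=
  ereal_sup [set `|P.@[x 0]|%:E | x in Omega].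

End Polynomials.

Section Chebyshev.
Variable R : realType.

Definition is_chebyshev (n : nat) (T : {poly R}) : Prop :=
  forall x : R, -1 <= x <= 1 -> T.[x] = cos (n%:R * acos x).

Lemma is_chebyshev_uniq n (T U : {poly R}) :
  is_chebyshev n T -> is_chebyshev n U -> T = U.
Proof.
move=> hT hU; apply/eqP; rewrite -subr_eq0; apply/negPn/negP => TU0.
pose s : seq R := [seq (i.+1%:R)^-1 | i <- iota 0 (size (T - U))].
have uniq_s : uniq s.
  rewrite map_inj_uniq ?iota_uniq// => i j /invr_inj /eqP.
  by rewrite eqr_nat eqSS => /eqP.
have root_s : all (root (T - U)) s.
  apply/allP => _ /mapP[i _ ->]; rewrite rootE hornerD hornerN.
  have i01 : -1 <= (i.+1%:R : R)^-1 <= 1.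
    rewrite (@le_trans _ _ 0) ?lerN10 ?invr_ge0 ?ler0n//=.
    by rewrite invf_le1 ?ltr0n// ler1n.
  by rewrite hT// hU// subrr.
have := max_poly_roots TU0 root_s uniq_s.
by rewrite size_map size_iota ltnn.
Qed.

Lemma is_chebyshev0 : is_chebyshev 0 1.
Proof. by move=> x _; rewrite mul0r cos0 hornerC. Qed.

Lemma is_chebyshev1 : is_chebyshev 1 'X.
Proof. by move=> x hx; rewrite mul1r hornerX acosK// in_itv. Qed.

Lemma is_chebyshevSS n (T U : {poly R}) :
  is_chebyshev n T -> is_chebyshev n.+1 U ->
  is_chebyshev n.+2 (2%:R *: ('X * U) - T).
Proof.
move=> hT hU x hx.
have cx : cos (acos x) = x by rewrite acosK// in_itv.
rewrite hornerD hornerN hornerZ hornerM hornerX hT// hU//.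
set t := acos x; rewrite -/t in cx.
have -> : n.+2%:R * t = n.+1%:R * t + t.
  by rewrite -[n.+2]addn1 natrD mulrDl mul1r.
have -> : n%:R * t = n.+1%:R * t - t.
  by rewrite -[n.+1]addn1 natrD mulrDl mul1r addrK.
rewrite cosB cosD cx mulr_natl mulr2n [x * _]mulrC opprD addrA addrK.
by [].
Qed.

Lemma is_chebyshev_exists n : exists T, is_chebyshev n T.
Proof.
suff [T [_ [hT _]]] : exists T U, is_chebyshev n T /\ is_chebyshev n.+1 U.
  by exists T.
elim: n => [|n [T [U [hT hU]]]].
  by exists 1, 'X; split; [exact: is_chebyshev0|exact: is_chebyshev1].
by exists U, (2%:R *: ('X * U) - T); split=> //; exact: is_chebyshevSS.
Qed.

(* The unique polynomial satisfying [is_chebyshev n]; the default value 0 is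
   never used, see chebyshevP. *)
Definition chebyshev (n : nat) : {poly R} :=
  xget 0 [set T | is_chebyshev n T].

Lemma chebyshevP n : is_chebyshev n (chebyshev n).
Proof.
by have [T hT] := is_chebyshev_exists n; rewrite /chebyshev; case: xgetP => // /(_ T).
Qed.

End Chebyshev.

(* Main.v *)
Require Import Defs.
From HB Require Import structures.
From mathcomp Require Import all_boot all_order all_algebra.
From mathcomp Require Import mpoly.
From mathcomp Require Import boolp classical_sets set_interval reals ereal.
From mathcomp Require Import trigo.
From mathcomp Require polyrcf.
From mathcomp Require Import ring lra.
Import Order.TTheory GRing.Theory Num.Theory.
Local Open Scope ring_scope.
Local Open Scope classical_set_scope.

(** Everything reduces to the univariate Chebyshev problem on [a, b], by
restricting polynomials to the diagonal t |-> t *: onev.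

A monomial 'X_[m] becomes 'X^(mdeg m) there, so the condition that the
coefficients of degree n sum to 1 says exactly that the restriction of P has
leading coefficient 1 in degree n (lemma Pi_starP). The diagonal of Omega is
[a, b], so the supremum of |P| over Omega is at least that of the restriction
over [a, b], and the latter is at least the constant c of the theorem by
Chebyshev's theorem (lemma monic_max_ge_cheb_dev). That theorem is proved in
the classical way: if a monic p of degree n stayed below c in absolute value,
then q - p, where q is the monic Chebyshev polynomial of [a, b], would have the
alternating signs of q at its n + 1 extremal points, hence n roots
(lemma alternation_size), although its degree is less than n.

Conversely q gives rise to the ridge polynomial q(<v, x>). Since <v, 1> = 1,
its restriction to the diagonal is q itself (lemma diagpoly_ridge), so it lies
in Pi_star n; since <v, x> stays in [a, b] for x in Omega, it is bounded by c
on Omega. It is the extremal polynomial. *)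

(** * Sign changes and roots *)

Lemma alternation_size (R : rcfType) (r : {poly R}) (x : nat -> R) (n : nat) :
    r != 0 ->
    (forall k, (k < n)%N -> x k.+1 < x k) ->
    (forall k, (k < n)%N -> r.[x k.+1] * r.[x k] < 0) ->
  (n < size r)%N.
Proof.
move=> r0 x_decr r_alt.
(* The lower bound x n on the roots makes the induction work: the root found in
   the next gap is then automatically new. *)
suff [s [<- us rs _]] : exists s : seq R,
    [/\ size s = n, uniq s, all (root r) s & all (> x n) s].
  exact: max_poly_roots.
elim: n x_decr r_alt => [|n IHn] x_decr r_alt; first by exists [::].
have [||s [sz_s us rs xs]] := IHn.
- by move=> k kn; apply: x_decr; apply: ltnW.
- by move=> k kn; apply: r_alt; apply: ltnW.
have xn := x_decr n (ltnSn n).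
have [y] := polyrcf.poly_ivtoo (ltW xn) (r_alt n (ltnSn n)).
rewrite in_itv /= => /andP[ly yu] ry.
exists (y :: s); split=> /=.
- by rewrite sz_s.
- rewrite us andbT; apply/negP => ys.
  by have := lt_trans yu (allP xs y ys); rewrite ltxx.
- by rewrite ry.
- rewrite ly /=; apply/allP => z zs; exact: lt_trans xn (allP xs z zs).
Qed.

(** * Chebyshev's extremal problem on an interval *)

Section UnivariateChebyshev.
Variable R : realType.
Local Notation T := (chebyshev R).

Lemma chebyshevSS n : T n.+2 = 2%:R *: ('X * T n.+1) - T n.
Proof.
have TSS := is_chebyshevSS (@chebyshevP R n) (@chebyshevP R n.+1).
exact: is_chebyshev_uniq (@chebyshevP R n.+2) TSS.
Qed.

(** The index is shifted because T_0 = 1 does not follow the pattern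
2 ^ (n - 1) for the leading coefficient. *)
Lemma size_lead_chebyshev n :
  size (T n.+1) = n.+2 /\ lead_coef (T n.+1) = 2 ^+ n.
Proof.
(* The recurrence has two terms: the size of T_n must be carried along, to know
   that it does not reach the leading term of 'X * T_(n+1). *)
suff [] : [/\ (size (T n) <= n.+1)%N, size (T n.+1) = n.+2
            & lead_coef (T n.+1) = 2 ^+ n] by [].
elim: n => [|n [sz0 sz1 lc1]].
  rewrite (is_chebyshev_uniq (@chebyshevP R 0) (@is_chebyshev0 R)).
  rewrite (is_chebyshev_uniq (@chebyshevP R 1) (@is_chebyshev1 R)).
  by rewrite size_poly1 size_polyX lead_coefX expr0.
have U0 : T n.+1 != 0 by rewrite -size_poly_eq0 sz1.
have szD : size (2%:R *: ('X * T n.+1)) = n.+3.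
  by rewrite size_scale ?pnatr_eq0// mulrC size_mulX// sz1.
have lt_sz : (size (- T n) < size (2%:R *: ('X * T n.+1))%R)%N.
  by rewrite szD size_polyN; apply: leq_trans (leqnSn _).
rewrite chebyshevSS sz1 size_polyDl// szD lead_coefDl//.
by rewrite lead_coefZ lead_coefM lead_coefX mul1r lc1 exprS.
Qed.

Lemma normr_chebyshev_le1 n (x : R) : -1 <= x <= 1 -> `|(T n).[x]| <= 1.
Proof. by move=> hx; rewrite chebyshevP// cos_max. Qed.

Section Interval.
Variables (a b : R) (n : nat).
Hypotheses (ab : a < b) (n_gt0 : (0 < n)%N).

(** The least deviation from zero on [a, b] of monic polynomials of degree n. *)
Definition cheb_dev : R := ((b - a) / 2) ^+ n * (1 / 2 ^+ (n - 1)).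

(** The increasing affine map that sends [a, b] onto [-1, 1]. *)
Definition to_unit_itv : {poly R} :=
  (2 / (b - a)) *: 'X + (- 1 - 2 * (a / (b - a)))%:P.

(** The normalisation cheb_dev compensates exactly the leading coefficient
2 ^ (n - 1) of T_n and the slope 2 / (b - a) of to_unit_itv. *)
Definition monic_chebyshev : {poly R} := cheb_dev *: (T n \Po to_unit_itv).

Lemma to_unit_itvE t : to_unit_itv.[t] = - 1 + 2 * ((t - a) / (b - a)).
Proof. by rewrite /to_unit_itv hornerD hornerZ hornerX hornerC; ring. Qed.

Lemma monic_chebyshevE t :
  monic_chebyshev.[t] =
  cheb_dev * (T n).[- 1 + 2 * ((t - a) / (b - a))].
Proof. by rewrite /monic_chebyshev hornerZ horner_comp to_unit_itvE. Qed.

Lemma cheb_dev_gt0 : 0 < cheb_dev.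
Proof.
by rewrite mulr_gt0 ?exprn_gt0 ?divr_gt0 ?exprn_gt0 ?subr_gt0.
Qed.

Lemma size_monic_chebyshev : size monic_chebyshev = n.+1.
Proof.
have ba0 : 2 / (b - a) != 0 :> R by rewrite gt_eqF// divr_gt0 ?subr_gt0.
rewrite size_scale ?gt_eqF ?cheb_dev_gt0// size_comp_poly2.
  by case: n n_gt0 => // m _; have [] := size_lead_chebyshev m.
rewrite size_polyDl size_scale// size_polyX//.
by apply: leq_ltn_trans (size_polyC_leq1 _) _.
Qed.

Lemma lead_monic_chebyshev : monic_chebyshev`_n = 1.
Proof.
have ba : 0 < b - a by rewrite subr_gt0.
have ba0 : 2 / (b - a) != 0 :> R by rewrite gt_eqF// divr_gt0.
have szC (c : R) : (size c%:P < size ((2 / (b - a)) *: 'X)%R)%N.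
  rewrite size_scale// size_polyX; exact: leq_ltn_trans (size_polyC_leq1 _) _.
have szL : size to_unit_itv = 2 by rewrite size_polyDl// size_scale// size_polyX.
have lcL : lead_coef to_unit_itv = 2 / (b - a).
  by rewrite lead_coefDl// lead_coefZ lead_coefX mulr1.
have -> : n = (size monic_chebyshev).-1 by rewrite size_monic_chebyshev.
rewrite -[LHS]/(lead_coef _) lead_coefZ lead_coef_comp ?szL// lcL.
rewrite /cheb_dev; case: n n_gt0 => // m _.
have [-> ->] := size_lead_chebyshev m.
rewrite subn1/= mulrA -[_ * _ * 2 ^+ m]mulrA div1r mulVf ?expf_neq0 ?pnatr_eq0//.
rewrite mulr1 -exprMn mulrA divfK ?pnatr_eq0// divff ?expr1n//.
by rewrite gt_eqF.
Qed.

(** Chebyshev's lower bound. A polynomial below cheb_dev on the whole of [a, b]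
is too small to affect, when subtracted, the signs of monic_chebyshev at the
points where it takes the values cheb_dev and - cheb_dev in turn; the
difference, whose terms of degree n cancel, would have too many roots. *)
Lemma monic_max_ge_cheb_dev (p : {poly R}) :
    (size p <= n.+1)%N -> p`_n = 1 ->
  exists2 t, a <= t <= b & cheb_dev <= `|p.[t]|.
Proof.
move=> szp pn; apply: contrapT => small.
have {}small t : a <= t <= b -> `|p.[t]| < cheb_dev.
  by move=> tab; rewrite ltNge; apply/negP => ct; apply: small; exists t.
have ba : 0 < b - a by rewrite subr_gt0.
have n0 : 0 < n%:R :> R by rewrite ltr0n.
(* Extremal points of T_n, from 1 down to -1, then carried back to [a, b]. *)
pose u k : R := cos (k%:R * pi / n%:R).
pose x k : R := a + (b - a) / 2 * (u k + 1).
have angle k : (k <= n)%N -> 0 <= k%:R * @pi R / n%:R <= pi.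
  move=> kn; rewrite divr_ge0 ?mulr_ge0 ?pi_ge0//=.
  by rewrite ler_pdivrMr// mulrC ler_wpM2l ?pi_ge0// ler_nat.
have u_itv k : -1 <= u k <= 1 by rewrite cos_geN1 cos_le1.
have xab k : a <= x k <= b.
  have /andP[u1 u2] := u_itv k.
  have : 0 <= (b - a) / 2 * (u k + 1) by rewrite mulr_ge0 ?divr_ge0//; lra.
  have : 0 <= (b - a) / 2 * (1 - u k) by rewrite mulr_ge0 ?divr_ge0//; lra.
  rewrite /x; lra.
have qx k : (k <= n)%N -> monic_chebyshev.[x k] = cheb_dev * (-1) ^+ k.
  move=> kn; rewrite monic_chebyshevE; congr (_ * _).
  have -> : - 1 + 2 * ((x k - a) / (b - a)) = u k.
    by rewrite /x; field; rewrite gt_eqF.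
  rewrite chebyshevP// cosK ?in_itv ?angle//.
  have -> : n%:R * (k%:R * pi / n%:R) = k%:R * pi :> R by field; rewrite gt_eqF.
  elim: k {kn} => [|k IHk]; first by rewrite mul0r cos0.
  by rewrite -natr1 mulrDl mul1r cosDpi IHk exprS mulN1r.
pose r := monic_chebyshev - p.
have sgn_r k : (k <= n)%N -> 0 < (-1) ^+ k * r.[x k].
  move=> kn; rewrite hornerD hornerN qx// mulrBr mulrCA -expr2 sqrr_sign mulr1.
  rewrite subr_gt0; apply: le_lt_trans (small _ (xab k)).
  by apply: le_trans (ler_norm _) _; rewrite normrMsign.
have r0 : r != 0.
  by apply/eqP => r0; have := sgn_r 0 (leq0n n); rewrite r0 horner0 mulr0 ltxx.
have : (n < size r)%N.
  apply: (alternation_size _ _ x) => // k kn.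
    rewrite ltrD2l ltr_pM2l ?divr_gt0// ltrD2r ltr_cos ?in_itv ?angle ?(ltnW kn)//.
    by rewrite ltr_pM2r ?invr_gt0// ltr_pM2r ?pi_gt0// ltr_nat.
  have := mulr_gt0 (sgn_r k.+1 kn) (sgn_r k (ltnW kn)).
  by rewrite mulrACA exprS mulN1r mulNr -expr2 sqrr_sign mulN1r oppr_gt0.
apply/negP; rewrite -leqNgt; apply/leq_sizeP => j.
rewrite leq_eqVlt => /predU1P[<-|nj].
  by rewrite coefB lead_monic_chebyshev pn subrr.
by rewrite coefB !nth_default ?subrr ?size_monic_chebyshev// (leq_trans szp).
Qed.

End Interval.
End UnivariateChebyshev.

(** * Restriction to the diagonal *)

Section Diagonal.
Variables (R : realType) (d : nat).
Implicit Types P Q : {mpoly R[d]}.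

(** The restriction t |-> P(t, ..., t), see horner_diagpoly. *)
Definition diagpoly P : {poly R} := mmap (@polyC R) (fun=> 'X) P.

Lemma diagpolyX (m : 'X_{1..d}) : diagpoly 'X_[m] = 'X^(mdeg m).
Proof. by rewrite /diagpoly mmapX /mmap1 prodrXr mdegE. Qed.

Lemma diagpolyZ c P : diagpoly (c *: P) = c *: diagpoly P.
Proof. by rewrite /diagpoly mmapZ mul_polyC. Qed.

Lemma diagpolyD P Q : diagpoly (P + Q) = diagpoly P + diagpoly Q.
Proof. exact: mmapD. Qed.

Lemma diagpoly_sum (I : Type) (r : seq I) (p : pred I) (F : I -> {mpoly R[d]}) :
  diagpoly (\sum_(i <- r | p i) F i) = \sum_(i <- r | p i) diagpoly (F i).
Proof. exact: (big_morph diagpoly diagpolyD (mmap0 _ _)). Qed.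

Lemma diagpolyXn P k : diagpoly (P ^+ k) = diagpoly P ^+ k.
Proof. by rewrite /diagpoly rmorphXn. Qed.

Lemma horner_diagpoly P t : (diagpoly P).[t] = P.@[(t *: onev R d) 0].
Proof.
rewrite /diagpoly /mmap mevalE horner_sum; apply: eq_bigr => m _.
rewrite hornerM hornerC; congr (_ * _).
rewrite /mmap1 horner_prod; apply: eq_bigr => i _.
by rewrite hornerXn !mxE mulr1.
Qed.

Lemma size_diagpoly P : (size (diagpoly P) <= msize P)%N.
Proof.
rewrite /diagpoly /mmap (leq_trans (size_sum _ _ _))//.
rewrite big_seq; apply/bigmax_leqP_seq => m _ mP.
rewrite /mmap1 prodrXr -mdegE mul_polyC.
apply: leq_trans (size_scale_leq _ _) _.
by rewrite size_polyXn; exact: msize_mdeg_lt.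
Qed.

Lemma coef_diagpoly_top n (c : 'X_{1..d} -> R) Q : (0 < n)%N ->
    Pi_le n.-1 Q ->
  (diagpoly (\sum_(m : 'X_{1..d < n.+1} | mdeg m == n) c m *: 'X_[m] + Q))`_n
    = \sum_(m : 'X_{1..d < n.+1} | mdeg m == n) c m.
Proof.
move=> n0; rewrite /Pi_le /= prednK// => szQ.
rewrite diagpolyD coefD [X in _ + X]nth_default ?addr0.
  rewrite diagpoly_sum coef_sum; apply: eq_bigr => m /eqP dm.
  by rewrite diagpolyZ diagpolyX coefZ coefXn dm eqxx mulr1.
exact: leq_trans (size_diagpoly Q) szQ.
Qed.

(** Membership in Pi_star depends only on the total degree and on the diagonal
restriction: in degree n the latter collects the sum of all the coefficients
of degree n. *)
Lemma Pi_starP n P : (0 < n)%N ->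
  Pi_star n P <-> (msize P <= n.+1)%N /\ (diagpoly P)`_n = 1.
Proof.
move=> n0; split=> [[c [Q [c1 szQ ->]]]|[szP P1]].
  split; last by rewrite coef_diagpoly_top.
  apply: leq_trans (msizeD_le _ _) _; rewrite geq_max; apply/andP; split.
    apply: leq_trans (msize_sum _ _ _) _; apply/bigmax_leqP => m _.
    by apply: leq_trans (msizeZ_le _ _) _; rewrite msizeX bmdeg.
  by apply: leq_trans szQ _; rewrite prednK.
pose Q := \sum_(m : 'X_{1..d < n.+1} | mdeg m != n) P@_m *: 'X_[m].
have PE : P = \sum_(m : 'X_{1..d < n.+1} | mdeg m == n) P@_m *: 'X_[m] + Q.
  by rewrite {1}(mpolywE szP) (bigID (fun m : 'X_{1..d < n.+1} => mdeg m == n)).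
have szQ : Pi_le n.-1 Q.
  rewrite /Pi_le /= prednK//; apply: leq_trans (msize_sum _ _ _) _.
  apply/bigmax_leqP => m mn; apply: leq_trans (msizeZ_le _ _) _.
  by rewrite msizeX ltn_neqAle mn -ltnS bmdeg.
exists (fun m => P@_m), Q; split=> //.
by have := coef_diagpoly_top n (fun m => P@_m) Q n0 szQ; rewrite -PE P1.
Qed.

(** * Ridge polynomials *)

Definition linform (v : 'rV[R]_d) : {mpoly R[d]} := \sum_i v 0 i *: 'X_i.

(** The polynomial x |-> q(<v, x>), see ridgeE. *)
Definition ridge (q : {poly R}) v : {mpoly R[d]} :=
  \sum_(i < size q) q`_i *: linform v ^+ i.

Lemma linformE v (x : 'rV[R]_d) : (linform v).@[x 0] = dotv v x.
Proof.
rewrite /linform raddf_sum /=; apply: eq_bigr => i _.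
by rewrite mevalZ mevalXU.
Qed.

Lemma ridgeE q v (x : 'rV[R]_d) : (ridge q v).@[x 0] = q.[dotv v x].
Proof.
rewrite /ridge raddf_sum /= horner_coef; apply: eq_bigr => i _.
by rewrite mevalZ rmorphXn /= linformE.
Qed.

Lemma msize_linformX v i : (msize (linform v ^+ i) <= i.+1)%N.
Proof.
elim: i => [|i IHi]; first by rewrite expr0 msize1.
have [->|l0] := eqVneq (linform v) 0; first by rewrite expr0n msize0.
rewrite exprS msizeM ?expf_neq0//.
have sz_l : (msize (linform v) <= 2)%N.
  apply: leq_trans (msize_sum _ _ _) _; apply/bigmax_leqP => j _.
  by apply: leq_trans (msizeZ_le _ _) _; rewrite msizeX mdeg1.
by have := leq_add sz_l IHi; rewrite addSn; case: (_ + _)%N.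
Qed.

Lemma msize_ridge q v : (msize (ridge q v) <= size q)%N.
Proof.
apply: leq_trans (msize_sum _ _ _) _; apply/bigmax_leqP => i _.
apply: leq_trans (msizeZ_le _ _) _.
exact: leq_trans (msize_linformX v i) (ltn_ord i).
Qed.

(** On the diagonal <v, t *: onev> = t, so that the ridge polynomial restricts
to its profile q; this is where the normalisation <v, 1> = 1 enters. *)
Lemma diagpoly_ridge q v : dotv v (onev R d) = 1 -> diagpoly (ridge q v) = q.
Proof.
move=> v1.
have dl : diagpoly (linform v) = 'X.
  rewrite diagpoly_sum (eq_bigr (fun i => v 0 i *: 'X)).
    rewrite -scaler_suml -[RHS]scale1r -v1; congr (_ *: _).
    by apply: eq_bigr => i _; rewrite mxE mulr1.
  by move=> i _; rewrite diagpolyZ diagpolyX mdeg1.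
rewrite diagpoly_sum -[RHS]coefK poly_def; apply: eq_bigr => i _.
by rewrite diagpolyZ diagpolyXn dl.
Qed.

End Diagonal.

(** * The extremal problem on a diagonally-determined set *)

Theorem theorem3p1 (R : realType) (d n : nat) (d_gt0 : (0 < d)%N)
    (n_gt0 : (0 < n)%N) (Omega : set 'rV[R]_d) (v : 'rV[R]_d) (a b : R)
    (ab : a < b) (Omega_dd : diagonally_determined Omega v a b) :
  let c : R := ((b - a) / 2) ^+ n * (1 / 2 ^+ (n - 1)) in
  ereal_inf [set supnorm Omega P | P in Pi_star n] = c%:E /\
  exists Pstar : {mpoly R[d]},
    [/\ forall x : 'rV[R]_d,
          Pstar.@[x 0] =
          c * (chebyshev R n).[- 1 + 2 * ((dotv v x - a) / (b - a))],
        Pi_star n Pstar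
      & supnorm Omega Pstar = ereal_inf [set supnorm Omega P | P in Pi_star n]].
Proof.
move=> c; have [diagE v1 v_itv] := Omega_dd.
pose Pstar := ridge R d (monic_chebyshev R a b n) v.
have PstarE (x : 'rV[R]_d) : Pstar.@[x 0] =
    c * (chebyshev R n).[- 1 + 2 * ((dotv v x - a) / (b - a))].
  by rewrite ridgeE monic_chebyshevE.
have Pstar_in : Pi_star n Pstar.
  apply/Pi_starP => //; rewrite diagpoly_ridge// lead_monic_chebyshev//.
  by split=> //; rewrite (leq_trans (msize_ridge _ _ _ _))// size_monic_chebyshev.
have lower P : Pi_star n P -> (c%:E <= supnorm Omega P)%E.
  move=> /Pi_starP[]// szP P1.
  have [t tab ct] := monic_max_ge_cheb_dev R a b n ab n_gt0 (diagpoly R d P)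
    (leq_trans (size_diagpoly R d P) szP) P1.
  have Ot : Omega (t *: onev R d).
    suff : diagset Omega t by [].
    by rewrite diagE /= in_itv.
  apply: le_trans (_ : `|P.@[(t *: onev R d) 0]|%:E <= _)%E.
    by rewrite lee_fin -horner_diagpoly.
  by apply: ereal_sup_ubound; exists (t *: onev R d).
have upper : (supnorm Omega Pstar <= c%:E)%E.
  apply: ge_ereal_sup => _ [x Ox <-]; rewrite lee_fin PstarE normrM.
  have c0 : 0 < c by exact: cheb_dev_gt0.
  rewrite gtr0_norm// ler_piMr ?(ltW c0)// normr_chebyshev_le1//.
  have /andP[vx1 vx2] := v_itv x Ox.
  have ba : 0 < b - a by rewrite subr_gt0.
  have : 0 <= (dotv v x - a) / (b - a) by rewrite divr_ge0 ?subr_ge0// ltW.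
  have : (dotv v x - a) / (b - a) <= 1 by rewrite ler_pdivrMr// mul1r; lra.
  lra.
have inf_c : ereal_inf [set supnorm Omega P | P in Pi_star n] = c%:E.
  apply/eqP; rewrite eq_le; apply/andP; split.
    by apply: le_trans upper; apply: ereal_inf_lbound; exists Pstar.
  by apply: le_ereal_inf_tmp => _ [P PPi <-]; exact: lower.
split=> //; exists Pstar; split=> //.
by rewrite inf_c; apply/eqP; rewrite eq_le upper lower.
Qed.
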